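(* Let $D$ be any distribution over $\mathcal{X}\times\{\pm1\}$, and let $\ell\colon\{\pm1\}\times\mathbb{R}\to\mathbb{R}_+$ be a loss for which there is a constant $C\in\mathbb{R}$ with $\ell_{-1}(v)+\ell_1(v)=C$ for all $v\in\mathbb{R}$. Suppose $\bar D=\mathrm{IDN}(D,f)$ for some $f\colon\mathcal{X}\to[0,\tfrac12)$, and let $\rho_{\max}=\max_{x\in\mathcal{X}}f(x)$. Then for any scorer $s\colon\mathcal{X}\to\mathbb{R}$, $$\mathrm{reg}(s;D,\ell)\le\frac{1}{1-2\rho_{\max}}\cdot\mathrm{reg}(s;\bar D,\ell).$$ Further, if $\sup_{x\in\mathcal{X}}\mathrm{reg}(\bar\eta(x),s(x),s^*(x))\le R<+\infty$, then for any $\alpha\in[0,1]$, $$\mathrm{reg}(s;D,\ell)\le\frac{1}{(1-2\rho_{\max})^{1-\alpha}}\cdot R^{\alpha}\cdot\big(\mathbb{E}_{X\sim M}[w(X)]\big)^{\alpha}\cdot\big(\mathrm{reg}(s;\bar D,\ell)\big)^{1-\alpha},$$ where $w(x)=(1-2f(x))^{-1}$.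
   Context: $\mathcal{X}$ is an instance space; all functions are taken to be measurable. A distribution $D$ over $\mathcal{X}\times\{\pm1\}$ of a pair $(X,Y)$ has marginal $M=\mathbb{P}(X)$, class-probability function $\eta(x)=\mathbb{P}(Y=1\mid X=x)$ and base rate $\pi=\mathbb{P}(Y=1)\in(0,1)$. A scorer is any $s\colon\mathcal{X}\to\mathbb{R}$. With $\ell_y(v)=\ell(y,v)$, the conditional risk is $L(\eta,v)=\eta\,\ell_1(v)+(1-\eta)\,\ell_{-1}(v)$ and the $\ell$-risk is $R(s;D,\ell)=\mathbb{E}_{(X,Y)\sim D}[\ell(Y,s(X))]=\mathbb{E}_{X\sim M}[L(\eta(X),s(X))]$. A Bayes-optimal scorer is any $s^*\in\operatorname{argmin}_s R(s;D,\ell)$, the minimum being over all scorers (assumed to exist), and the $\ell$-regret is $\mathrm{reg}(s;D,\ell)=R(s;D,\ell)-R(s^*;D,\ell)$. With overloaded notation, $\mathrm{reg}(\eta,v,v^* )=L(\eta,v)-L(\eta,v^* )$ for $\eta\in[0,1]$, $v,v^*\in\mathbb{R}$. Instance-dependent noise: for $f\colon\mathcal{X}\to[0,\tfrac12)$, $\mathrm{IDN}(D,f)$ is the distribution of $(X,\bar Y)$ obtained by drawing $(X,Y)\sim D$ and then flipping the label with probability $f(X)$. It has the same marginal $M$, and $\bar\eta(x)=\mathbb{P}(\bar Y=1\mid X=x)$ denotes its class-probability function. For losses whose partial losses sum to a constant, the Bayes-optimal scorers for $D$ and for $\bar D=\mathrm{IDN}(D,f)$ coincide; $s^*$ denotes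 such a common Bayes-optimal scorer. *)

(* Defs.v *)
From HB Require Import structures.
From mathcomp Require Import all_boot all_order all_algebra.
From mathcomp Require Import all_classical all_reals all_analysis.
From mathcomp Require Import measurable_realfun.

Set Implicit Arguments.
Unset Strict Implicit.
Unset Printing Implicit Defensive.

Import Order.TTheory GRing.Theory Num.Theory.
Import numFieldNormedType.Exports.

Local Open Scope classical_set_scope.
Local Open Scope ring_scope.
Local Open Scope ereal_scope.

(* The label set {-1, +1} is encoded by [bool]: [true] is +1, [false] is -1,
   and flipping a label is Boolean negation.  A distribution of a pair (X, Y)
   is a probability on the product space [T * bool]. *)

Section marginal.
Context d (T : measurableType d) (R : realType).

Definition instance_of (z : T * bool) : T := z.1.

HB.instance Definition _ :=
  isMeasurableFun.Build _ _ _ _ instance_of measurable_fst.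

Definition marginal (D : probability (T * bool)%type R) : probability T R :=
  distribution D instance_of.

Definition base_rate (D : probability (T * bool)%type R) : \bar R :=
  D [set z | z.2 = true].

Definition class_probability (D : probability (T * bool)%type R)
    (eta : {mfun T >-> R}) : Prop :=
  (forall x, (0 <= eta x <= 1)%R) /\
  (forall A : set T, measurable A ->
     \int[marginal D]_(x in A) (eta x)%:E = D (A `*` [set true])).

End marginal.

Section risk.
Context d (T : measurableType d) (R : realType).
Implicit Types (D : probability (T * bool)%type R) (s : {mfun T >-> R}).
Implicit Type l : bool -> {mfun R >-> R}.

Definition cond_risk l (eta v : R) : R :=
  (eta * l true v + (1 - eta) * l false v)%R.

Definition cond_regret l (eta v vstar : R) : R :=
  (cond_risk l eta v - cond_risk l eta vstar)%R.

Definition risk D l s : \bar R := 'E_D[fun z => l z.2 (s z.1)].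

Definition bayes_optimal D l s : Prop :=
  forall s' : {mfun T >-> R}, risk D l s <= risk D l s'.

(* A chosen Bayes-optimal scorer; it is the zero scorer, a junk value, when
   the minimum of the risk is not attained.  Which minimiser is chosen is
   irrelevant to [regret]. *)
Definition bayes_scorer D l : {mfun T >-> R} :=
  xget (cst 0%R : {mfun T >-> R}) [set s | bayes_optimal D l s].

Definition regret D l s : \bar R := risk D l s - risk D l (bayes_scorer D l).

End risk.

(* The law of (X, Y (+) U), where (X, Y) ~ D and, conditionally on (X, Y),
   U ~ Bernoulli (f X).  When [f x] is outside of [0, 1], [bernoulli_prob (f x)]
   is the Dirac mass at [false] (no flip), so that [idn D f] is always a
   probability. *)
Section instance_dependent_noise.
Context d (T : measurableType d) (R : realType).
Variables (D : probability (T * bool)%type R) (f : {mfun T >-> R}).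

Definition idn (A : set (T * bool)) : \bar R :=
  \int[D]_z bernoulli_prob (f z.1) [set u | A (z.1, z.2 (+) u)].

Let measurable_integrand A : measurable A -> measurable_fun [set: T * bool]
  (fun z : T * bool => bernoulli_prob (f z.1) [set u | A (z.1, z.2 (+) u)]).
Proof.
move=> mA.
have mk : measurable_fun [set: T * bool]
    ((bernoulli_prob : R -> pprobability bool R) \o (f \o fst)).
  apply: measurableT_comp; first exact: measurable_bernoulli_prob.
  exact: measurableT_comp.
pose g (w : (T * bool) * bool) := (w.1.1, w.1.2 (+) w.2).
have mg : measurable_fun setT g.
  apply/measurable_fun_pairP; split => /=.
    exact: (measurableT_comp measurable_fst measurable_fst).
  rewrite (_ : _ \o _ = fun w : (T * bool) * bool =>
    if w.1.2 then ~~ w.2 else w.2); last by apply/funext => -[[? []] []].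
  apply: measurable_fun_ifT.
  - exact: (measurableT_comp measurable_snd measurable_fst).
  - exact: (measurable_neg measurable_snd).
  - exact: measurable_snd.
have mgA : g @^-1` A \in measurable.
  by rewrite inE -[X in measurable X]setTI; exact: mg.
have := measurable_fun_xsection_finite_kernel (kprobability mk) mgA.
apply: eq_measurable_fun => z _.
congr (bernoulli_prob _ _).
by apply/seteqP; split => u /=; rewrite /xsection/= inE.
Qed.

Let idn0 : idn set0 = 0.
Proof.
by rewrite /idn; apply: integral0_eq => z _; exact: measure0.
Qed.

Let idn_ge0 A : 0 <= idn A.
Proof. by apply: integral_ge0 => z _; exact: measure_ge0. Qed.

Let idn_sigma_additive : semi_sigma_additive idn.
Proof.
move=> U mU tU mUU; rewrite [X in _ --> X](_ : _ = \int[D]_z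
  (\sum_(n <oo) bernoulli_prob (f z.1) [set u | U n (z.1, z.2 (+) u)])).
  apply/cvg_closeP; split.
    by apply: is_cvg_nneseries => n _ _; exact: idn_ge0.
  by rewrite closeE// integral_nneseries// => n; exact: measurable_integrand.
apply: eq_integral => z _.
rewrite (_ : [set u | _] = \bigcup_n [set u | U n (z.1, z.2 (+) u)])//.
apply/esym/cvg_lim => //; apply: measure_semi_sigma_additive => //.
apply/trivIsetP => i j _ _ ij; apply/seteqP; split => // u [/= Ui Uj].
have : (U i `&` U j) (z.1, z.2 (+) u) by [].
by move/trivIsetP : tU => /(_ i j Logic.I Logic.I ij) ->.
Qed.

HB.instance Definition _ := isMeasure.Build _ _ R idn
  idn0 idn_ge0 idn_sigma_additive.

Let idn_setT : idn [set: T * bool] = 1.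
Proof.
transitivity (\int[D]_z (cst 1 z)).
  apply: eq_integral => z _.
  exact: (@probability_setT _ _ _ (bernoulli_prob (f z.1))).
by rewrite integral_cst// mul1e; exact: probability_setT.
Qed.

HB.instance Definition _ :=
  @Measure_isProbability.Build _ _ R idn idn_setT.

End instance_dependent_noise.

(* Main.v *)
Require Import Defs.
From HB Require Import structures.
From mathcomp Require Import all_boot all_order all_algebra.
From mathcomp Require Import all_classical all_reals all_analysis.
From mathcomp Require Import measurable_realfun.
From mathcomp Require Import ring lra.

Set Implicit Arguments.
Unset Strict Implicit.
Unset Printing Implicit Defensive.

Import Order.TTheory GRing.Theory Num.Theory.
Import numFieldNormedType.Exports.

Local Open Scope classical_set_scope.
Local Open Scope ring_scope.
Local Open Scope ereal_scope.

(* Write r(x) for the conditional regret of s against sstar under etabar and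
   w = 1 / (1 - 2 f).  Since the partial losses sum to a constant, the regret
   of s is the integral of w r for the clean distribution and of r for the noisy
   one.  Replacing s by sstar where r >= 0 shows that the negative part of r
   has null integral; so sstar is also optimal for the noisy distribution, and
   r may be replaced by its positive part p.  The first bound is
   w <= 1 / (1 - 2 rho_max); the second one interpolates geometrically between
   this and the bound of the integral of w p by B times the integral of w. *)

(** * Integration against Bernoulli mixtures: the noisy law and the disintegration of a law *)

(** The measure [nu] is the law at the end of a chain of kernels: draw [v] from [mu], then a
    Bernoulli bit, then apply [h] as a Dirac kernel. Integration against composed kernels extends
    the identity from sets to nonnegative functions. It is used below with [h] a label flip and with
    [h] the identity. *)
Lemma integral_bernoulli_mixture (R : realType) (d d' : measure_display)
    (V : measurableType d) (U : measurableType d')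
    (mu : probability V R) (nu : {measure set U -> \bar R})
    (p : V -> R) (h : V * bool -> U) :
  measurable_fun [set: V] p -> (forall v, (0 <= p v <= 1)%R) ->
  measurable_fun [set: V * bool] h ->
  (forall A, measurable A ->
    nu A = \int[mu]_v bernoulli_prob (p v) [set b | A (h (v, b))]) ->
  forall g : U -> \bar R, (forall u, 0 <= g u) -> measurable_fun [set: U] g ->
  \int[nu]_u g u = \int[mu]_v
    ((p v)%:E * g (h (v, true)) + (1 - p v)%:E * g (h (v, false))).
Proof.
move=> mp p01 mh nuE g g0 mg.
have mc : measurable_fun [set: unit] (fun=> mu : pprobability V R).
  exact: measurable_cst.
have mk : measurable_fun [set: unit * V]
    ((bernoulli_prob : R -> pprobability bool R) \o (p \o snd)).
  by apply: measurableT_comp; [exact: measurable_bernoulli_prob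
                              |exact: measurableT_comp].
have mh' : measurable_fun [set: unit * V * bool]
    (fun w : unit * V * bool => h (w.1.2, w.2)).
  apply: (measurableT_comp mh); apply/measurable_fun_pairP; split => /=.
    exact: (measurableT_comp measurable_snd measurable_fst).
  exact: measurable_snd.
pose kV : R.-sfker unit ~> V := kprobability mc.
pose kB : R.-sfker (unit * V)%type ~> bool := kprobability mk.
pose kU : R.-sfker (unit * V * bool)%type ~> U := @kdirac _ _ _ _ R _ mh'.
pose kBU : R.-sfker (unit * V)%type ~> U := mkcomp kB kU.
pose kVU : R.-sfker unit ~> U := mkcomp kV kBU.
have kBUE v e : (forall u, 0 <= e u) -> measurable_fun [set: U] e ->
    \int[kBU (tt, v)]_u e u = (p v)%:E * e (h (v, true)) +
       (1 - p v)%:E * e (h (v, false)).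
  move=> e0 me; rewrite integral_kcomp// integral_bernoulli_prob.
  - by rewrite !integral_dirac// !diracT !mul1e.
  - exact: p01.
  - by move=> b; exact: integral_ge0.
(* Both measures agree on measurable sets: [kBUE] at an indicator gives exactly the Bernoulli
   integrand of [nuE]. *)
have -> : \int[nu]_u g u = \int[kVU tt]_u g u.
  apply: (eq_measure_integral (kVU tt)) => A mA _; rewrite nuE//.
  apply: eq_integral => v _; rewrite bernoulli_probE//.
  have := @kBUE v (EFin \o \1_A); rewrite integral_indic// setIT => ->.
  - by rewrite !diracE.
  - by move=> u; rewrite lee_fin.
  - exact/measurable_EFinP.
by rewrite integral_kcomp//; apply: eq_integral => v _; rewrite kBUE.
Qed.

Lemma measurable_fun_bool_pair (d d' : measure_display) (T : measurableType d)
    (U : measurableType d') (g : T * bool -> U) :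
  (forall b, measurable_fun [set: T] (fun x => g (x, b))) ->
  measurable_fun [set: T * bool] g.
Proof.
move=> mg.
rewrite (_ : g = fun z => if z.2 then g (z.1, true) else g (z.1, false)).
  apply: measurable_fun_ifT => /=; first exact: measurable_snd.
  - exact: (measurableT_comp (mg true) measurable_fst).
  - exact: (measurableT_comp (mg false) measurable_fst).
by apply/funext => -[x []].
Qed.

Lemma integral_idn (R : realType) (d : measure_display) (T : measurableType d)
    (D : probability (T * bool)%type R) (f : {mfun T >-> R}) :
  (forall x, (0 <= f x <= 1)%R) ->
  forall g : T * bool -> \bar R, (forall z, 0 <= g z) ->
  measurable_fun [set: T * bool] g ->
  \int[idn D f]_z g z = \int[D]_z
    ((f z.1)%:E * g (z.1, ~~ z.2) + (1 - f z.1)%:E * g z).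
Proof.
move=> f01 g g0 mg.
rewrite (@integral_bernoulli_mixture _ _ _ _ _ D _ (fun z => f z.1)
  (fun w => (w.1.1, w.1.2 (+) w.2)))//=.
- by apply: eq_integral => -[x b] _ /=; rewrite addbT addbF.
- exact: measurableT_comp.
- apply: measurable_fun_bool_pair => b /=.
  apply/measurable_fun_pairP; split => /=; first exact: measurable_fst.
  case: b.
    rewrite (_ : _ \o _ = negb \o snd); last first.
      by apply/funext => -[x []].
    exact: (measurable_neg measurable_snd).
  rewrite (_ : _ \o _ = snd); last by apply/funext => -[x []].
  exact: measurable_snd.
Qed.

(** The definition of [eta] fixes only the mass of sets with positive label. The mass of sets with
    negative label follows by subtraction from the marginal, and the two slices of a set then
    exhibit [D] as a Bernoulli mixture over its marginal. *)
Lemma integral_class_probability (R : realType) (d : measure_display)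
    (T : measurableType d) (D : probability (T * bool)%type R)
    (eta : {mfun T >-> R}) :
  class_probability D eta ->
  forall g : T * bool -> \bar R, (forall z, 0 <= g z) ->
  measurable_fun [set: T * bool] g ->
  \int[D]_z g z = \int[marginal D]_x
    ((eta x)%:E * g (x, true) + (1 - eta x)%:E * g (x, false)).
Proof.
move=> [eta01 etaE] g g0 mg.
have mb (b : bool) : measurable_fun [set: T] (fun x : T => (x, b)).
  by apply/measurable_fun_pairP; split;
    [exact: measurable_id|exact: measurable_cst].
have mbA (b : bool) (A : set (T * bool)) :
    measurable A -> measurable [set x : T | A (x, b)].
  by move=> mA; have := mb b measurableT A mA; rewrite setTI.
have etaFE B : measurable B ->
    \int[marginal D]_(x in B) (1 - eta x)%:E = D (B `*` [set false]).
  move=> mB; have Dfin : D (B `*` [set true]) \is a fin_num.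
    by rewrite fin_num_measure//; apply: measurableX.
  (* Adding the finite mass of the positive slice to both sides reduces the claim to the total mass
     over [B], which is the marginal of [B]. *)
  rewrite -[LHS](addeK _ Dfin) -[RHS](addeK _ Dfin); congr (_ - _).
  rewrite -measureU//; last 3 first.
  - by apply: measurableX.
  - by apply: measurableX.
  - by apply/seteqP; split => -[x []] //= [[_ +] [_ +]].
  rewrite -etaE// -ge0_integralD//; last 4 first.
  - by move=> x _; rewrite lee_fin subr_ge0; have /andP[] := eta01 x.
  - apply/measurable_EFinP/measurable_funTS; exact: measurable_funB.
  - by move=> x _; rewrite lee_fin; have /andP[] := eta01 x.
  - exact/measurable_EFinP/measurable_funTS.
  under eq_integral do rewrite -EFinD subrK.
  rewrite integral_cst// mul1e /marginal /distribution /pushforward/=.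
  congr (D _); apply/seteqP; split => -[x b] /=; last by move=> [[]|[]].
  by case: b => ?; [right|left].
rewrite (@integral_bernoulli_mixture _ _ _ _ _ (marginal D) _ eta id)//.
move=> A mA.
have mAt := mbA true A mA; have mAf := mbA false A mA.
(* [A] is the disjoint union of its positive and its negative slice, each a product with a singleton
   label. *)
rewrite [LHS](_ : _ =
    \int[marginal D]_(x in [set x | A (x, true)]) (eta x)%:E +
    \int[marginal D]_(x in [set x | A (x, false)]) (1 - eta x)%:E); last first.
  rewrite etaE// etaFE// -measureU//; last 3 first.
  - by apply: measurableX.
  - by apply: measurableX.
  - by apply/seteqP; split => -[x []] //= [[_ +] [_ +]].
  congr (D _); apply/seteqP; split => -[x b] /=.
    by case: b => ?; [left|right].
  by move=> [[? ->]|[? ->]].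
rewrite [X in X + _]integral_mkcond [X in _ + X]integral_mkcond.
rewrite -ge0_integralD//; last 4 first.
- move=> x _; rewrite patchE; case: ifP => // _.
  by rewrite lee_fin; have /andP[] := eta01 x.
- apply/(measurable_restrictT _ _).1 => //.
  exact/measurable_EFinP/measurable_funTS.
- move=> x _; rewrite patchE; case: ifP => // _.
  by rewrite lee_fin subr_ge0; have /andP[] := eta01 x.
- apply/(measurable_restrictT _ _).1 => //.
  apply/measurable_EFinP/measurable_funTS; exact: measurable_funB.
apply: eq_integral => x _; rewrite bernoulli_probE// !patchE !diracE.
have E b : (b \in [set b | A (x, b)]) = (x \in [set x | A (x, b)]) by [].
by rewrite !E; congr (_ + _); case: (x \in _); rewrite ?mule1 ?mule0.
Qed.

(** * Measurability and sign of weights, losses and conditional risks *)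

Lemma measurable_funV_gt0 (R : realType) (d : measure_display)
    (T : measurableType d) (g : T -> R) :
  (forall x, (0 < g x)%R) -> measurable_fun [set: T] g ->
  measurable_fun [set: T] (fun x => (g x)^-1)%R.
Proof.
move=> g0 mg.
rewrite (_ : (fun _ => _) = (@powR R)^~ (-1)%R \o g).
  exact: (measurableT_comp (measurable_powR _)).
by apply/funext => x /=; rewrite powR_inv1// ltW.
Qed.

Lemma measurable_loss (R : realType) (d : measure_display)
    (T : measurableType d) (l : bool -> {mfun R >-> R}) (s : {mfun T >-> R}) :
  measurable_fun [set: T * bool] (fun z => l z.2 (s z.1)).
Proof.
apply: measurable_fun_bool_pair => b.
by apply: (@measurableT_comp _ _ _ _ _ _ (l b)).
Qed.

Lemma measurable_cond_risk (R : realType) (d : measure_display)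
    (T : measurableType d) (l : bool -> {mfun R >-> R})
    (eta s : {mfun T >-> R}) :
  measurable_fun [set: T] (fun x => cond_risk l (eta x) (s x)).
Proof.
apply: measurable_funD; apply: measurable_funM => //.
- exact: measurableT_comp.
- exact: measurable_funB.
- exact: measurableT_comp.
Qed.

Lemma cond_risk_ge0 (R : realType) (l : bool -> {mfun R >-> R}) (eta v : R) :
  (0 <= eta <= 1)%R -> (forall y v, (0 <= l y v)%R) ->
  (0 <= cond_risk l eta v)%R.
Proof.
by move=> /andP[e0 e1] l0; rewrite addr_ge0// mulr_ge0// subr_ge0.
Qed.

(** * Noisy and clean risks as integrals over the common marginal *)

Lemma integral_marginal_idn (R : realType) (d : measure_display)
    (T : measurableType d) (D : probability (T * bool)%type R)
    (f : {mfun T >-> R}) :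
  (forall x, (0 <= f x <= 1)%R) ->
  forall g : T -> \bar R, (forall x, 0 <= g x) -> measurable_fun [set: T] g ->
  \int[marginal (idn D f)]_x g x = \int[marginal D]_x g x.
Proof.
move=> f01 g g0 mg; rewrite !ge0_integral_distribution// integral_idn//=.
  apply: eq_integral => -[x b] _ /=.
  have /andP[fx0 fx1] := f01 x.
  rewrite -ge0_muleDl ?lee_fin ?subr_ge0//.
  by rewrite -EFinD subrKC mul1e.
exact: measurableT_comp.
Qed.

Lemma risk_idn (R : realType) (d : measure_display)
    (T : measurableType d) (D : probability (T * bool)%type R)
    (f etabar : {mfun T >-> R}) (l : bool -> {mfun R >-> R})
    (s : {mfun T >-> R}) :
  (forall x, (0 <= f x <= 1)%R) -> class_probability (idn D f) etabar ->
  (forall y v, (0 <= l y v)%R) ->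
  risk (idn D f) l s = \int[marginal D]_x (cond_risk l (etabar x) (s x))%:E.
Proof.
move=> f01 hetabar l0; have [eta01 _] := hetabar.
rewrite /risk unlock (integral_class_probability hetabar); last 2 first.
- by move=> z; rewrite lee_fin; exact: l0.
- by apply/measurable_EFinP; exact: (measurable_loss l s).
rewrite -(integral_marginal_idn D f01); last 2 first.
- by move=> x; rewrite lee_fin; exact: cond_risk_ge0.
- by apply/measurable_EFinP; exact: (measurable_cond_risk l etabar s).
by apply: eq_integral => x _; rewrite -!EFinM -EFinD.
Qed.

(* Unbiased loss correction: drawing the label from the noisy distribution,
   [l y v / (1 - 2 f x)] has conditional mean [l y v + C * f x / (1 - 2 f x)]
   given the clean label [y], so that no class-probability function for the
   clean distribution is needed. *)
Lemma risk_unflip (R : realType) (d : measure_display)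
    (T : measurableType d) (D : probability (T * bool)%type R)
    (f etabar : {mfun T >-> R}) (l : bool -> {mfun R >-> R}) (C : R)
    (s : {mfun T >-> R}) :
  (forall x, (0 <= f x < 2^-1)%R) -> class_probability (idn D f) etabar ->
  (forall y v, (0 <= l y v)%R) ->
  (forall v, (l false v + l true v = C)%R) ->
  risk D l s + \int[D]_z (C * f z.1 * (1 - 2 * f z.1)^-1)%:E =
  \int[marginal D]_x
    ((1 - 2 * f x)^-1 * cond_risk l (etabar x) (s x))%:E.
Proof.
move=> f012 hetabar l0 lC; have [eta01 _] := hetabar.
have f0 x : (0 <= f x)%R by have /andP[] := f012 x.
have w0 x : (0 < 1 - 2 * f x)%R by have /andP[] := f012 x; lra.
have f01 x : (0 <= f x <= 1)%R by have /andP[] := f012 x; lra.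
have C0 : (0 <= C)%R by rewrite -(lC 0%R) addr_ge0.
have mw : measurable_fun [set: T] (fun x => (1 - 2 * f x)^-1)%R.
  apply: measurable_funV_gt0 => //.
  by apply: measurable_funB => //; exact: measurable_funM.
have mw1 : measurable_fun [set: T * bool] (fun z => (1 - 2 * f z.1)^-1)%R.
  exact: (measurableT_comp mw).
have mf1 : measurable_fun [set: T * bool] (fun z => f z.1).
  exact: measurableT_comp.
have ml := measurable_loss l s.
rewrite /risk unlock -ge0_integralD//; last 4 first.
- by move=> z _; rewrite lee_fin; exact: l0.
- exact/measurable_EFinP.
- by move=> z _; rewrite lee_fin !mulr_ge0// invr_ge0 ltW.
- by apply/measurable_EFinP; do 2 apply: measurable_funM => //.
transitivity (\int[idn D f]_z ((1 - 2 * f z.1)^-1 * l z.2 (s z.1))%:E).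
  rewrite integral_idn//; last 2 first.
  - by move=> z; rewrite lee_fin mulr_ge0// invr_ge0 ltW.
  - by apply/measurable_EFinP; apply: measurable_funM => //.
  apply: eq_integral => -[x b] _ /=.
  rewrite -!EFinM -!EFinD; congr EFin.
  have -> : l (~~ b) (s x) = (C - l b (s x))%R.
    by rewrite -(lC (s x)); case: b => /=; ring.
  by field; rewrite gt_eqF.
rewrite (integral_class_probability hetabar); last 2 first.
- by move=> z; rewrite lee_fin mulr_ge0// invr_ge0 ltW.
- by apply/measurable_EFinP; apply: measurable_funM => //.
rewrite -(integral_marginal_idn D f01); last 2 first.
- move=> x; rewrite lee_fin; apply: mulr_ge0; last exact: cond_risk_ge0.
  by rewrite invr_ge0 ltW.
- apply/measurable_EFinP; apply: measurable_funM => //.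
  exact: measurable_cond_risk.
apply: eq_integral => x _; rewrite -!EFinM -EFinD; congr EFin.
by rewrite /= /cond_risk; ring.
Qed.

(** * Bounded functions, choice of the optimal scorer, real powers *)

Lemma integrable_bounded (R : realType) (d : measure_display)
    (T : measurableType d) (P : probability T R) (g : T -> R) (K : R) :
  measurable_fun [set: T] g -> (forall x, (`|g x| <= K)%R) ->
  P.-integrable [set: T] (EFin \o g).
Proof.
move=> mg gK; apply: measurable_bounded_integrable => //.
  by rewrite ltey_eq fin_num_measure.
exists K; split; first exact: num_real.
by move=> N KN x _; rewrite /= (le_trans (gK x))// ltW.
Qed.

(** Once some minimiser exists, the chosen scorer is a minimiser too, and any two minimisers have
    equal risk. *)
Lemma bayes_optimal_regretE (R : realType) (d : measure_display)
    (T : measurableType d) (D : probability (T * bool)%type R)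
    (l : bool -> {mfun R >-> R}) (sstar s : {mfun T >-> R}) :
  bayes_optimal D l sstar -> regret D l s = risk D l s - risk D l sstar.
Proof.
move=> opt; rewrite /regret; congr (_ - _).
have : bayes_optimal D l (bayes_scorer D l).
  by apply: (@xgetPex _ _ [set s | bayes_optimal D l s]); exists sstar.
by move=> opt'; apply/eqP; rewrite eq_le opt opt'.
Qed.

(** Split [Z] into powers of exponents [1 - alpha] and [alpha]; bound the first factor through
    [k * P], the second through [B * W]. *)
Lemma le_powR_interpolation (R : realType) (k P B W Z alpha : R) :
  (0 <= k -> 0 <= P -> 0 <= B -> 0 <= W -> 0 <= Z -> 0 <= alpha <= 1 ->
  Z <= k * P -> Z <= B * W ->
  Z <= k `^ (1 - alpha) * B `^ alpha * W `^ alpha * P `^ (1 - alpha))%R.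
Proof.
move=> k0 P0 B0 W0 Z0 /andP[a0 a1] ZkP ZBW.
have -> : Z = (Z `^ (1 - alpha) * Z `^ alpha)%R.
  (* The exponents sum to 1, which is nonzero, so the splitting holds even when [Z] is 0. *)
  rewrite -powRD; first by rewrite subrK powRr1.
  by rewrite subrK oner_eq0.
rewrite -[leRHS]mulrA [(W `^ _ * _)%R]mulrC mulrACA -!powRM//.
by apply: ler_pM; rewrite ?powR_ge0// ge0_ler_powR ?nnegrE ?subr_ge0// mulr_ge0.
Qed.

Lemma powRV (R : realType) (x r : R) :
  (0 <= x -> x^-1 `^ r = (x `^ r)^-1)%R.
Proof. by move=> x0; rewrite -powR_inv1// -powRrM mulN1r powRN. Qed.

Theorem proposition4 (R : realType) (d : measure_display) (T : measurableType d)
    (D : probability (T * bool)%type R)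
    (hpi : 0 < base_rate D < 1)
    (l : bool -> {mfun R >-> R})
    (hl0 : forall (y : bool) (v : R), (0 <= l y v)%R)
    (C : R) (hlC : forall v : R, (l false v + l true v = C)%R)
    (f : {mfun T >-> R})
    (hf : forall x : T, (0 <= f x < 2^-1)%R)
    (rho_max : R)
    (hrho : range f rho_max /\ ubound (range f) rho_max)
    (etabar : {mfun T >-> R})
    (hetabar : class_probability (idn D f) etabar)
    (sstar : {mfun T >-> R})
    (hsstar : bayes_optimal D l sstar)
    (s : {mfun T >-> R}) :
  regret D l s <= (1 / (1 - 2 * rho_max))%:E * regret (idn D f) l s
  /\
  (forall B : R,
     ereal_sup (range (fun x : T =>
       (cond_regret l (etabar x) (s x) (sstar x))%:E)) <= B%:E ->
   forall alpha : R, (0 <= alpha <= 1)%R ->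
     regret D l s <=
       (1 / (1 - 2 * rho_max) `^ (1 - alpha))%:E
       * (B `^ alpha)%:E
       * ('E_(marginal D)[fun x : T => (1 - 2 * f x)^-1%R]) `^ alpha
       * (regret (idn D f) l s) `^ (1 - alpha)).
Proof.
have [eta01 _] := hetabar.
have [[x0 _ fx0] f_ub] := hrho.
(* The maximum is attained at [x0], so it inherits the strict bound by 1/2. *)
have rho0 : (0 < 1 - 2 * rho_max)%R by have := hf x0; rewrite fx0; lra.
have f0 x : (0 <= f x)%R by have /andP[] := hf x.
have f01 x : (0 <= f x <= 1)%R by have /andP[] := hf x; lra.
have wV0 x : (0 < 1 - 2 * f x)%R by have /andP[] := hf x; lra.
pose k := ((1 - 2 * rho_max)^-1)%R.
pose w x := ((1 - 2 * f x)^-1)%R.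
have w1 x : (1 <= w x)%R.
  by rewrite invf_ge1//; have := f0 x; lra.
have w0 x : (0 <= w x)%R by rewrite (le_trans ler01).
have wk x : (w x <= k)%R.
  rewrite lef_pV2 ?posrE//; have : (f x <= rho_max)%R by apply: f_ub; exists x.
  lra.
have k0 : (0 <= k)%R by rewrite invr_ge0 ltW.
have mw : measurable_fun [set: T] w.
  apply: measurable_funV_gt0 => //.
  by apply: measurable_funB => //; exact: measurable_funM.

(* Bounded integrands and real-valued formulas for the risk differences *)
pose c (s' : T -> R) x := cond_risk l (etabar x) (s' x).
have c0 s' x : (0 <= c s' x)%R by exact: cond_risk_ge0.
(* The partial losses are nonnegative, have weights at most 1 and sum to [C]. This bound makes every
   integrand below bounded, hence integrable. *)
have cC s' x : (c s' x <= C)%R.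
  rewrite -(hlC (s' x)) addrC /c /cond_risk; have /andP[e0 e1] := eta01 x.
  by apply: lerD; rewrite ler_piMl// lerBlDr lerDl.
have C0 : (0 <= C)%R by exact: le_trans (c0 s x0) (cC s x0).
have mc (s' : {mfun T >-> R}) : measurable_fun [set: T] (c s').
  exact: measurable_cond_risk.
set M := marginal D.
have int_w (g : T -> R) :
    measurable_fun [set: T] g -> (forall x, (`|g x| <= C)%R) ->
    M.-integrable [set: T] (EFin \o (fun x => w x * g x)%R).
  move=> mg gC; apply: (@integrable_bounded _ _ _ _ _ (k * C)).
    exact: measurable_funM.
  by move=> x; rewrite normrM ler_pM// ger0_norm.
have int_g (g : T -> R) :
    measurable_fun [set: T] g -> (forall x, (`|g x| <= C)%R) ->
    M.-integrable [set: T] (EFin \o g).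
  by move=> mg gC; exact: integrable_bounded gC.
have ncC s' x : (`|c s' x| <= C)%R by rewrite ger0_norm.
pose r (s' : T -> R) x := (c s' x - c sstar x)%R.
have mr (s' : {mfun T >-> R}) : measurable_fun [set: T] (r s').
  exact: measurable_funB.
have rC s' x : (`|r s' x| <= C)%R.
  have := c0 s' x; have := c0 sstar x; have := cC s' x; have := cC sstar x.
  by rewrite ler_norml /r => *; apply/andP; split; lra.
pose I (g : T -> R) := (\int[M]_x g x)%R.
have EFinI g : M.-integrable [set: T] (EFin \o g) ->
    \int[M]_x (g x)%:E = (I g)%:E.
  by move=> ig; rewrite fineK//; exact: integrable_fin_num.
have intcst (b : R) : M.-integrable [set: T] (EFin \o (fun=> b)).
  by apply: (@integrable_bounded _ _ _ _ _ `|b|%R).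
have Icst (b : R) : I (fun=> b) = b.
  rewrite /I Rintegral_cst// -[RHS]mulr1; congr (_ * _)%R.
  exact: (congr1 fine (probability_setT M)).
have risk_idnE (s' : {mfun T >-> R}) : risk (idn D f) l s' = (I (c s'))%:E.
  rewrite (risk_idn s' f01 hetabar hl0) EFinI//.
  exact: int_g (mc s') (ncC s').
(* The offset produced by the loss correction. It does not depend on the scorer and is finite, its
   integrand being at most [C * k], so it cancels in risk differences. *)
pose K := \int[D]_z (C * f z.1 * w z.1)%:E.
have Kfin : K \is a fin_num.
  apply: integrable_fin_num => //.
  apply: (@integrable_bounded _ _ _ _ (fun z => C * f z.1 * w z.1)%R (C * k)).
    apply: measurable_funM; first apply: measurable_funM => //.
      exact: measurableT_comp.
    exact: (measurableT_comp mw).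
  move=> z; rewrite ger0_norm ?mulr_ge0//; apply: ler_pM => //.
    exact: mulr_ge0.
  by rewrite ler_piMr//; have /andP[] := f01 z.1.
have riskE (s' : {mfun T >-> R}) :
    risk D l s' = (I (fun x => w x * c s' x)%R)%:E - K.
  rewrite -EFinI; last exact: int_w (mc s') (ncC s').
  by rewrite -(risk_unflip s' hf hetabar hl0 hlC) addeK.
have riskB (s' : {mfun T >-> R}) :
    risk D l s' - risk D l sstar = (I (fun x => w x * r s' x)%R)%:E.
  rewrite !riskE -(fineK Kfin) -!EFinB; congr EFin.
  rewrite opprB addrA subrK /I -RintegralB//; [|exact: int_w (mc _) (ncC _)..].
  by apply: eq_Rintegral => x _; rewrite /r mulrBr.
have risk_idnB (s' : {mfun T >-> R}) :
    risk (idn D f) l s' - risk (idn D f) l sstar = (I (r s'))%:E.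
  by rewrite !risk_idnE -EFinB /I -RintegralB//;
    exact: int_g (mc _) (ncC _).
have Iwr_ge0 (s' : {mfun T >-> R}) : (0 <= I (fun x => w x * r s' x))%R.
  rewrite -lee_fin -riskB suber_ge0; first exact: hsstar.
  by rewrite riskE fin_numB Kfin.

(* Negligibility of the negative part of the conditional regret *)
pose p (s' : T -> R) x := Num.max (r s' x) 0%R.
have p0 s' x : (0 <= p s' x)%R by rewrite le_max lexx orbT.
have mp (s' : {mfun T >-> R}) : measurable_fun [set: T] (p s').
  exact: measurable_maxr.
have pC s' x : (`|p s' x| <= C)%R.
  rewrite ger0_norm// ge_max C0 andbT.
  exact: le_trans (ler_norm _) (rC s' x).
(* Replacing [s'] by [sstar] where [s'] is not strictly better turns [r s'] into its
   negative part, so optimality of [sstar] makes that part negligible. *)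
have clip (s' : {mfun T >-> R}) :
    (I (fun x => w x * r s' x) <= I (fun x => w x * p s' x))%R /\
    I (r s') = I (p s').
  pose u x := if (c s' x < c sstar x)%R then s' x else sstar x.
  have mu : measurable_fun [set: T] u.
    by apply: measurable_fun_ifT => //; exact: measurable_fun_ltr.
  pose n : {mfun T >-> R} := HB.pack u (isMeasurableFun.Build _ _ _ _ u mu).
  have nE x : r n x = Num.min (r s' x) 0%R.
    rewrite /r /c /= /u; case: ltP => h.
      by rewrite min_l// subr_le0 ltW.
    by rewrite subrr min_r// subr_ge0.
  have rn x : r s' x = (p s' x + r n x)%R by rewrite nE addr_max_min addr0.
  have n0 x : (r n x <= 0)%R by rewrite nE ge_min lexx orbT.
  (* As [w >= 1] and [r n <= 0], the weight only lowers the integral. Clean optimality makes the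
     weighted integral nonnegative, so [I (r n)] is squeezed to 0. *)
  have Iwn : (I (fun x => w x * r n x) <= I (r n))%R.
    apply: le_Rintegral => //;
      [exact: int_w (mr n) (rC n)|exact: int_g (mr n) (rC n)|].
    by move=> x _; rewrite ler_neMl.
  have In0 : (I (r n) <= 0)%R.
    rewrite -[leRHS](Icst 0%R); apply: le_Rintegral => //.
    exact: int_g (mr n) (rC n).
  have In : I (r n) = 0%R.
    by apply/eqP; rewrite eq_le In0 (le_trans (Iwr_ge0 n)).
  split.
    apply: le_Rintegral => //;
      [exact: int_w (mr s') (rC s')|exact: int_w (mp s') (pC s')|].
    by move=> x _; rewrite ler_wpM2l// /p le_max lexx.
  rewrite -[RHS]addr0 -In /I -RintegralD//; last 2 first.
  - exact: int_g (mp s') (pC s').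
  - exact: int_g (mr n) (rC n).
  exact: eq_Rintegral.
have Ip0 s' : (0 <= I (p s'))%R by apply: Rintegral_ge0.
(* By [clip], the noisy risk of any scorer exceeds that of [sstar] by the integral of a nonnegative
   function. *)
have hsstar_idn : bayes_optimal (idn D f) l sstar.
  move=> s'; rewrite -suber_ge0; last by rewrite risk_idnE.
  rewrite risk_idnB lee_fin.
  by rewrite (clip s').2.

(* The two regret bounds *)
rewrite !(bayes_optimal_regretE s hsstar) !(bayes_optimal_regretE s hsstar_idn).
rewrite riskB risk_idnB (clip s).2 div1r -/k.
have ZkP : (I (fun x => w x * p s x) <= k * I (p s))%R.
  rewrite /I -RintegralZl//; last exact: int_g (mp s) (pC s).
  apply: le_Rintegral => //; [exact: int_w (mp s) (pC s)| |].
    apply: (@integrable_bounded _ _ _ _ _ (k * C)).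
      exact: measurable_funM.
    by move=> x; rewrite normrM ler_pM// ger0_norm.
  by move=> x _; rewrite ler_wpM2r.
split; first by rewrite -EFinM lee_fin (le_trans (clip s).1).
move=> B supB alpha a01.
have rB x : (r s x <= B)%R.
  rewrite -lee_fin; apply: le_trans supB; apply: ereal_sup_ubound.
  by exists x.
(* Pointwise, [r s] may be negative, so the sign of [B] is found by averaging: [B] is at least the
   mean of [r s], which equals that of [p s]. *)
have B0 : (0 <= B)%R.
  rewrite -(Icst B) (le_trans (Ip0 s))// -(clip s).2.
  by apply: le_Rintegral => //; exact: int_g (mr s) (rC s).
have iw : M.-integrable [set: T] (EFin \o w).
  by apply: (@integrable_bounded _ _ _ _ _ k) => // x; rewrite ger0_norm.
rewrite unlock (EFinI w)// !poweR_EFin -!EFinM lee_fin.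
rewrite (le_trans (clip s).1)// div1r -(powRV _ (ltW rho0)).
(* Here [Z] is the integral of [w * p s], [P] that of [p s], and [W] that of [w]. The bound by
   [B * W] holds because both [r s] and 0 are at most [B], hence so is [p s]. *)
apply: le_powR_interpolation => //.
- exact: Rintegral_ge0.
- by apply: Rintegral_ge0 => x _; rewrite mulr_ge0.
- rewrite /I -RintegralZl//; apply: le_Rintegral => //.
  + exact: int_w (mp s) (pC s).
  + apply: (@integrable_bounded _ _ _ _ _ (B * k)).
      exact: measurable_funM.
    by move=> x; rewrite normrM ler_pM// ger0_norm.
  + move=> x _; rewrite mulrC ler_wpM2r// ge_max B0 andbT; exact: rB.
Qed.
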